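(* Let $G=(V,E)$ be a finite graph and let $s\in V$. In the model $O$, any two $s$-out-cluster increasing events $A,B$ are positively correlated, i.e. \[ P_O(A)\,P_O(B)\le P_O(A\cap B).\]
   Context: $G=(V,E)$ is a fixed undirected graph. Model $O$ (random orientation): every edge of $G$ is directed in one of its two possible directions, each with probability $1/2$, independently of all other edges. $P_O$ denotes probability in this model. The space of realizations is $\Omega_O=\{-1,1\}^{E}$, where for each edge the values $-1,1$ correspond (by some fixed choice) to its two possible directions. For a vertex $v$ and a realization $\omega\in\Omega_O$, the out-cluster $\overrightarrow{C}_v(\omega)\subseteq V$ is the set of all vertices $u$ for which there is a directed path from $v$ to $u$ (by convention $v$ itself belongs to it). The cluster is a set of vertices, not of edges. An event $A\subseteq\Omega_O$ is called $s$-out-cluster increasing if for all $\omega,\omega'\in\Omega_O$, $\overrightarrow{C}_s(\omega)\supseteq\overrightarrow{C}_s(\omega')$ and $\omega'\in A$ together imply $\omega\in A$. *)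

(* Defs.v *)
From mathcomp Require Import all_boot all_order all_algebra.

Set Implicit Arguments.
Unset Strict Implicit.
Unset Printing Implicit Defensive.

Import Order.TTheory GRing.Theory Num.Theory.
Local Open Scope ring_scope.

(* Parallel edges and loops are allowed; a loop is an edge [e] for which
   [ends e] is a singleton. Simple graphs are the case where [ends] is
   injective and takes only values of cardinality 2. *)
Record graph := Graph {
  vertex : finType;
  edge : finType;
  ends : edge -> {set vertex};
  card_ends : forall e, (0 < #|ends e| <= 2)%N
}.

(* The fixed choice of which of the two directions of an edge corresponds to
   which sign; the booleans [true] and [false] stand for 1 and -1.
   The arc [dir c e b] goes from its first to its second component. *)
Record direction_choice (G : graph) := DirectionChoice {
  dir : edge G -> bool -> vertex G * vertex G;
  dir_ends : forall e, ends e = [set (dir e true).1; (dir e true).2];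
  dir_rev : forall e, dir e false = ((dir e true).2, (dir e true).1)
}.

Lemma direction_choice_inhabited (G : graph) : inhabited (direction_choice G).
Proof.
have ex e : exists p : vertex G * vertex G, ends e == [set p.1; p.2].
  have := card_ends e; case: (posnP #|ends e|) => [-> //|_] /= le2.
  have [/eqP/cards1P[x ex]|/eqP ne1] := eqVneq #|ends e| 1%N.
    by exists (x, x); rewrite ex setUid.
  have /cards2P[x [y [_ exy]]] : #|ends e| == 2%N.
    rewrite eqn_leq le2 ltn_neqAle eq_sym (introN eqP ne1) /=.
    by case/andP: (card_ends e).
  by exists (x, y); rewrite exy.
pose p e := xchoose (ex e).
constructor; apply: (@DirectionChoice G
  (fun e b => if b then p e else ((p e).2, (p e).1))) => e //=.
exact/eqP/(xchooseP (ex e)).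
Qed.

Definition realization (G : graph) := {ffun edge G -> bool}.

Section ModelO.
Variables (G : graph) (c : direction_choice G).
Implicit Types (w : realization G) (A : {set realization G}).

Definition arc w : rel (vertex G) :=
  fun x y => [exists e, dir c e (w e) == (x, y)].

Definition out_cluster (s : vertex G) w : {set vertex G} :=
  [set u | connect (arc w) s u].

Definition out_cluster_increasing (s : vertex G) A : Prop :=
  forall w w', out_cluster s w' \subset out_cluster s w ->
    w' \in A -> w \in A.

End ModelO.

(* The product over the edges of the uniform measure on [bool]. *)
Definition PO (R : realFieldType) (G : graph) (A : {set realization G}) : R :=
  \sum_(w in A) \prod_(e : edge G) 2^-1.

(* Main.v *)
Require Import Defs.
From mathcomp Require Import all_boot all_order all_algebra.
From mathcomp Require Import lra.

(** Reveal the orientation one edge at a time, always choosing an unrevealed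
    edge [e] that has an end [x] in the set [D] of vertices already known to be
    in the out-cluster, and let [y] be the other end. If [e] points from [x] to
    [y], then [y] is added to [D]; if it points towards [x], it is useless,
    because [x] is reached anyway. Either way [e] never matters again and can
    be discarded, so the average of a function of the out-cluster is the mean
    of its averages in two smaller explorations, one started from [y |: D] and
    one from [D] ([sum_explore_split]).

    Given two functions of the out-cluster that are increasing for inclusion,
    each of the two smaller explorations has nonnegative correlation by
    induction on the number of unrevealed edges. Moreover both functions have
    the larger average in the exploration started from [y |: D], so that
    Chebyshev's inequality for two-point averages carries the correlation over
    to their mixture ([explore_correlation]). When no unrevealed edge touches
    [D], the out-cluster is the constant [D].

    An out-cluster increasing event is a function of the out-cluster, and the
    indicator of an up-closed family of vertex sets (those containing the
    out-cluster of some realization in the event), so the theorem is the case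
    where [D] is the source alone and every edge is unrevealed. *)

Set Implicit Arguments.
Unset Strict Implicit.
Unset Printing Implicit Defensive.

Import Order.TTheory GRing.Theory Num.Theory.
Local Open Scope ring_scope.

Section Exploration.
Variables (G : graph) (c : direction_choice G).
Implicit Types (D T : {set vertex G}) (F : {set edge G}) (w : realization G).

Definition arc_in F w : rel (vertex G) :=
  fun x y => [exists e in F, dir c e (w e) == (x, y)].

(** Discarded edges keep an orientation in [w] that is ignored here, so that
    explorations with different sets of edges are averaged over the same
    space. *)
Definition explore D F w : {set vertex G} :=
  [set u | [exists x in D, connect (arc_in F w) x u]].

Definition flip (e : edge G) w : realization G :=
  [ffun e' => if e' == e then ~~ w e' else w e'].

Lemma flipK e : involutive (flip e).
Proof.
by move=> w; apply/ffunP => e'; rewrite !ffunE; case: eqP; rewrite ?negbK.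
Qed.

Lemma dir_negb e b : dir c e (~~ b) = ((dir c e b).2, (dir c e b).1).
Proof. by case: b; rewrite /= dir_rev //= -surjective_pairing. Qed.

Lemma sub_explore D F w : D \subset explore D F w.
Proof.
apply/subsetP => x xD; rewrite inE; apply/existsP; exists x.
by rewrite xD connect0.
Qed.

Lemma explore_closed D F w e : e \in F ->
  (dir c e (w e)).1 \in explore D F w -> (dir c e (w e)).2 \in explore D F w.
Proof.
move=> eF; rewrite !inE => /existsP[x /andP[xD xu]].
apply/existsP; exists x; rewrite xD /=; apply: connect_trans xu _.
apply: connect1; apply/existsP; exists e.
by rewrite eF -surjective_pairing eqxx.
Qed.

(** Together with [sub_explore] and [explore_closed], this characterizes
    [explore D F w] as a least closed set; the inclusions below use only these
    three facts and no paths. *)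
Lemma explore_min D F w T : D \subset T ->
    (forall e, e \in F -> (dir c e (w e)).1 \in T -> (dir c e (w e)).2 \in T) ->
  explore D F w \subset T.
Proof.
move=> DT clT; apply/subsetP => u; rewrite inE => /existsP[x /andP[xD]].
move/connectP=> [p px ->]; move/(subsetP DT): xD.
elim: p x px => [|y p IHp] //= x /andP[/existsP[e /andP[eF /eqP de]] py] xT.
by apply: IHp py _; have := clT e eF; rewrite de; apply.
Qed.

Lemma exploreS D D' F w : D \subset D' -> explore D F w \subset explore D' F w.
Proof.
move=> sDD'; apply: explore_min; last exact: explore_closed.
exact: subset_trans sDD' (sub_explore _ _ _).
Qed.

Lemma explore_subset_edges D F F' w :
  F \subset F' -> explore D F w \subset explore D F' w.
Proof.
move=> sFF'; apply: explore_min (sub_explore _ _ _) _ => e /(subsetP sFF').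
exact: explore_closed.
Qed.

Lemma explore_outward D F w e : e \in F -> (dir c e (w e)).1 \in D ->
  explore D F w = explore ((dir c e (w e)).2 |: D) (F :\ e) w.
Proof.
move=> eF xD; apply/eqP; rewrite eqEsubset; apply/andP; split.
  apply: explore_min => [|e' e'F].
    exact: subset_trans (subsetUr _ _) (sub_explore _ _ _).
  have [->|ne'] := eqVneq e' e; last by apply: explore_closed; rewrite !inE ne'.
  by move=> _; apply: (subsetP (sub_explore _ _ _)); rewrite !inE eqxx.
apply: explore_min => [|e']; last by case/setD1P=> _; apply: explore_closed.
rewrite subUset sub_explore sub1set andbT; apply: explore_closed => //.
exact: (subsetP (sub_explore _ _ _)).
Qed.

(** The edge points at a vertex that is a starting point already. *)
Lemma explore_inward D F w e : (dir c e (w e)).2 \in D ->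
  explore D F w = explore D (F :\ e) w.
Proof.
move=> xD; apply/eqP; rewrite eqEsubset andbC.
rewrite explore_subset_edges ?subsetDl //=.
apply: explore_min (sub_explore _ _ _) _ => e' e'F.
have [->|ne'] := eqVneq e' e; last by apply: explore_closed; rewrite !inE ne'.
by move=> _; apply: (subsetP (sub_explore _ _ _)).
Qed.

Lemma explore_flip D F e w : explore D (F :\ e) (flip e w) = explore D (F :\ e) w.
Proof.
apply/setP => u; rewrite !inE; apply: eq_existsb => x; congr (_ && _).
apply: eq_connect => {u}x y; apply: eq_existsb => e'.
by rewrite !inE ffunE; case: eqP.
Qed.

Lemma explore_isolated D F w :
  (forall e b, e \in F -> (dir c e b).1 \notin D) -> explore D F w = D.
Proof.
move=> out; apply/eqP; rewrite eqEsubset sub_explore andbT.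
by apply: explore_min => // e eF; rewrite (negPf (out e _ eF)).
Qed.

Lemma explore_source s w : explore [set s] setT w = out_cluster c s w.
Proof.
apply/setP => u; rewrite !inE.
have eqA : arc_in setT w =2 Defs.arc c w.
  by move=> x y; apply: eq_existsb => e; rewrite inE.
apply/existsP/idP => [[x]|su].
  by rewrite inE (eq_connect eqA) => /andP[/eqP->].
by exists s; rewrite inE eqxx (eq_connect eqA).
Qed.

Section Correlation.
Variable R : realFieldType.
Implicit Types f g : {set vertex G} -> R.

(** Pair each realization with its flip at [e]: exactly one of the two gives
    [e] the direction [b], which reveals its end, the other directs [e] back
    into [D], and the explorations without [e] are the same for both. *)
Lemma sum_explore_split f D F e b : e \in F -> (dir c e b).1 \in D ->
  (\sum_w f (explore D F w)) *+ 2 =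
    \sum_w f (explore ((dir c e b).2 |: D) (F :\ e) w)
    + \sum_w f (explore D (F :\ e) w).
Proof.
move=> eF xD; rewrite mulr2n [X in _ + X](reindex_inj (inv_inj (flipK e))) /=.
rewrite -!big_split; apply: eq_bigr => w _ /=.
have outE w' : w' e = b ->
    explore D F w' = explore ((dir c e b).2 |: D) (F :\ e) w'.
  by move=> we; rewrite (explore_outward (e := e)) ?we.
have backE w' : w' e = ~~ b -> explore D F w' = explore D (F :\ e) w'.
  by move=> we; rewrite (explore_inward F (e := e)) // we dir_negb.
have flipE : flip e w e = ~~ w e by rewrite ffunE eqxx.
have [we|] := eqVneq (w e) b.
  by rewrite (outE w) // (backE (flip e w)) ?flipE ?we // explore_flip.
move=> neb; have we : w e = ~~ b by move: neb; case: (w e) (b) => [] [].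
by rewrite (backE w) // (outE (flip e w)) ?flipE ?we ?negbK // explore_flip addrC.
Qed.

(** The product of the means falls short of the mean of the products by
    [(a1 - a2) * (b1 - b2) / 4]. *)
Lemma chebyshev2 (N a a1 a2 b b1 b2 m m1 m2 : R) :
    a *+ 2 = a1 + a2 -> b *+ 2 = b1 + b2 -> m *+ 2 = m1 + m2 ->
    a2 <= a1 -> b2 <= b1 -> a1 * b1 <= N * m1 -> a2 * b2 <= N * m2 ->
  a * b <= N * m.
Proof.
move=> ea eb em la lb h1 h2.
have -> : a = (a1 + a2) / 2 by lra.
have -> : b = (b1 + b2) / 2 by lra.
have -> : m = (m1 + m2) / 2 by lra.
have : 0 <= (a1 - a2) * (b1 - b2) by rewrite mulr_ge0 ?subr_ge0.
nra.
Qed.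

(** The set [D] is generalized in the induction on [#|F|], since one of the
    two branches enlarges it. The larger starting set reveals more in each
    realization, so the averages of [f] and [g] are ordered the same way in the
    two branches, which is what [chebyshev2] needs. *)
Lemma explore_correlation f g D F :
    {homo f : S T / S \subset T >-> S <= T} ->
    {homo g : S T / S \subset T >-> S <= T} ->
  (\sum_w f (explore D F w)) * (\sum_w g (explore D F w)) <=
    #|realization G|%:R * \sum_w f (explore D F w) * g (explore D F w).
Proof.
move=> fM gM; elim: {F}_.+1 {-2}F (ltnSn #|F|) D => // n IHn F leFn D.
have [/existsP[e /andP[eF /existsP[b xD]]]|none] :=
  boolP [exists e in F, exists b : bool, (dir c e b).1 \in D].
  have ltFn : (#|F :\ e| < n)%N by move: leFn; rewrite (cardsD1 e F) eF.
  have splitE h := sum_explore_split h eF xD.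
  have monoE (h : {set vertex G} -> R) :
      {homo h : S T / S \subset T >-> S <= T} ->
      \sum_w h (explore D (F :\ e) w)
        <= \sum_w h (explore ((dir c e b).2 |: D) (F :\ e) w) :> R.
    by move=> hM; apply: ler_sum => w _; apply/hM/exploreS/subsetUr.
  exact: (chebyshev2 (splitE f) (splitE g) (splitE (fun S => f S * g S))
    (monoE f fM) (monoE g gM) (IHn _ ltFn _) (IHn _ ltFn _)).
have constE w : explore D F w = D.
  apply: explore_isolated => e b eF; apply: contra none => xD.
  by apply/existsP; exists e; rewrite eF; apply/existsP; exists b.
under eq_bigr do rewrite constE.
under [X in _ * X <= _]eq_bigr do rewrite constE.
under [X in _ <= _ * X]eq_bigr do rewrite constE.
rewrite !sumr_const -[f D *+ _]mulr_natl -[g D *+ _]mulr_natl.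
by rewrite -[(_ * _) *+ _]mulr_natl mulrACA -mulrA.
Qed.

End Correlation.

(** Monotonicity in [out_cluster_increasing] compares out-clusters only,
    whereas [explore_correlation] asks for functions that are increasing on all
    vertex sets; this up-closure extends the event to every vertex set. *)
Definition cluster_upset (s : vertex G) (A : {set realization G}) :
    pred {set vertex G} :=
  fun T => [exists w in A, out_cluster c s w \subset T].

Lemma cluster_upset_homo (R : realFieldType) s A :
  {homo (fun T => (cluster_upset s A T)%:R : R) : S T / S \subset T >-> S <= T}.
Proof.
move=> S T sST; rewrite ler_nat; have [|//] := boolP (cluster_upset s A S).
case/existsP=> w /andP[wA sub]; rewrite lt0b; apply/existsP; exists w.
by rewrite wA (subset_trans sub sST).
Qed.

Lemma cluster_upsetE s A w : out_cluster_increasing c s A ->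
  cluster_upset s A (out_cluster c s w) = (w \in A).
Proof.
move=> hA; apply/existsP/idP => [[w' /andP[w'A sub]]|wA]; first exact: hA sub w'A.
by exists w; rewrite wA subxx.
Qed.

End Exploration.

Lemma PO_indicator (R : realFieldType) (G : graph) (A : {set realization G}) :
  PO R A = (\sum_w (w \in A)%:R) / #|realization G|%:R.
Proof.
rewrite /PO big_mkcond mulr_suml; apply: eq_bigr => w _.
rewrite prodr_const card_ffun card_bool natrX exprVn.
by case: (w \in A); rewrite ?mul1r ?mul0r.
Qed.

Theorem theorem3p2 (R : realFieldType) (G : graph) (c : direction_choice G)
    (s : vertex G) (A B : {set realization G})
    (hA : out_cluster_increasing c s A) (hB : out_cluster_increasing c s B) :
  PO R A * PO R B <= PO R (A :&: B).
Proof.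
have N_gt0 : (0 : R) < #|realization G|%:R.
  by rewrite ltr0n card_ffun card_bool expn_gt0.
have := explore_correlation c [set s] setT
  (@cluster_upset_homo _ c R s A) (@cluster_upset_homo _ c R s B).
under eq_bigr do rewrite explore_source cluster_upsetE //.
under [X in _ * X <= _]eq_bigr do rewrite explore_source cluster_upsetE //.
under [X in _ <= _ * X]eq_bigr do
  rewrite explore_source !cluster_upsetE // -natrM mulnb -in_setI.
rewrite !PO_indicator mulrACA -invfM => le.
rewrite ler_pdivrMr ?mulr_gt0 // (le_trans le) //.
by rewrite mulrA mulrAC mulfVK ?gt_eqF // mulrC.
Qed.
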